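(* Let $n>2$, $\lambda>0$ and $R=\frac{n}{\lambda}$. Let $\Omega$ be a bounded, measurable subset of $\mathbb{R}^n$, and let $\Sigma$ be any minimizer of the functional $E(\Sigma)=\mathrm{Per}(\Sigma)+\lambda|\Sigma\vartriangle\Omega|$ over measurable subsets of $\mathbb{R}^n$. Let $B_R\subset\mathbb{R}^n$ be a ball of radius $R$. If $B_R\subset\Omega$, then $B_R\cup\Sigma$ is also a minimizer of $E$. Moreover, if $B_R\subset\Omega^c$, then $(B_R\cup\Sigma^c)^c$ is also a minimizer of $E$.
   Context: For a Lebesgue measurable set $\Sigma\subset\mathbb{R}^n$, $\mathrm{Per}(\Sigma)=\int|\nabla\chi_\Sigma|\,dx\in[0,\infty]$ is the perimeter of $\Sigma$ in $\mathbb{R}^n$ (the total variation of its characteristic function). $|\cdot|$ denotes Lebesgue measure, $\vartriangle$ is symmetric difference, and $A^c=\mathbb{R}^n\setminus A$. A minimizer of $E$ is a measurable set $\Sigma$ with $E(\Sigma)\le E(\Sigma')$ for all measurable $\Sigma'\subset\mathbb{R}^n$. Balls are Euclidean balls (open or closed; the statement is meant for either). *)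

(* Defs.v *)
From HB Require Import structures.
From mathcomp Require Import all_boot all_order all_algebra.
From mathcomp Require Import all_classical all_reals all_analysis.
Set Implicit Arguments.
Unset Strict Implicit.
Unset Printing Implicit Defensive.
Import Order.TTheory GRing.Theory Num.Theory.
Import numFieldNormedType.Exports.
Local Open Scope classical_set_scope.
Local Open Scope ring_scope.

(* Borel sigma-algebra of R^n: the one generated by the coordinates. *)
Section borel_rV.
Variables (R : realType) (n : nat).

Definition coord_cylinder : set (set 'rV[R]_n) :=
  [set C | exists i : 'I_n, exists2 A : set R, measurable A &
           C = [set x : 'rV[R]_n | A (x ord0 i)]].

Definition rV_display : measure_display. Proof. exact: default_measure_display. Qed.

HB.instance Definition _ := @isMeasurable.Build rV_display 'rV[R]_n
  <<s coord_cylinder >> (@sigma_algebra0 _ setT _)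
  (@sigma_algebraC _ _) (@sigma_algebra_bigcup _ setT _).

Lemma measurable_rV_coord (i : 'I_n) :
  measurable_fun [set: 'rV[R]_n] (fun x : 'rV[R]_n => x ord0 i).
Proof.
move=> _ A mA; rewrite setTI; apply: sub_sigma_algebra.
by exists i; exists A.
Qed.

Lemma measurable_fun_rV d (T : measurableType d) (f : T -> 'rV[R]_n) :
  (forall i, measurable_fun setT (fun t => f t ord0 i)) -> measurable_fun setT f.
Proof.
move=> mf; apply: (@measurability _ _ _ _ setT f coord_cylinder) => //.
move=> _ [_ [i [A mA ->]] <-].
by have := mf i measurableT A mA.
Qed.

End borel_rV.

Section rV_cons.
Variables (R : realType) (n : nat).

Definition rV_cons (p : R * 'rV[R]_n) : 'rV[R]_n.+1 :=
  \row_i oapp (fun j => p.2 ord0 j) p.1 (unlift ord0 i).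

Definition rV_uncons (x : 'rV[R]_n.+1) : R * 'rV[R]_n :=
  (x ord0 ord0, \row_j x ord0 (lift ord0 j)).

Lemma rV_consK : cancel rV_cons rV_uncons.
Proof.
move=> [a x]; rewrite /rV_uncons /rV_cons !mxE unlift_none /=.
by congr (_, _); apply/rowP => j; rewrite !mxE liftK.
Qed.

Lemma rV_unconsK : cancel rV_uncons rV_cons.
Proof.
move=> x; apply/rowP => i; rewrite !mxE.
by case: unliftP => [j ->|->] //=; rewrite mxE.
Qed.

Lemma measurable_rV_cons : measurable_fun setT rV_cons.
Proof.
apply: measurable_fun_rV => i.
rewrite (_ : (fun _ => _) = fun p : R * 'rV[R]_n =>
  oapp (fun j => p.2 ord0 j) p.1 (unlift ord0 i)); last first.
  by apply/funext => p; rewrite mxE.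
case: unliftP => [j _|_] /=; last exact: measurable_fst.
exact: (measurableT_comp (@measurable_rV_coord R n j) measurable_snd).
Qed.

Lemma measurable_rV_uncons : measurable_fun setT rV_uncons.
Proof.
apply/measurable_fun_pairP; split; first exact: measurable_rV_coord.
apply: measurable_fun_rV => j.
rewrite (_ : (fun _ => _) = fun x : 'rV[R]_n.+1 => x ord0 (lift ord0 j)).
  exact: measurable_rV_coord.
by apply/funext => x; rewrite /= mxE.
Qed.

End rV_cons.

Section rV_measureS.
Local Open Scope ereal_scope.
Variables (R : realType) (n : nat).
Variable mu : {sigma_finite_measure set 'rV[R]_n -> \bar R}.

Let cons : measurableTypeR R * 'rV[R]_n -> 'rV[R]_n.+1 := @rV_cons R n.

Definition rV_measureS : set 'rV[R]_n.+1 -> \bar R :=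
  pushforward (@lebesgue_measure R \x mu) cons.

Let mcons : measurable_fun setT cons.
Proof. exact: measurable_rV_cons. Qed.

Let rV_measureS0 : rV_measureS set0 = 0.
Proof. by rewrite /rV_measureS /pushforward preimage_set0 measure0. Qed.

Let rV_measureS_ge0 A : 0 <= rV_measureS A.
Proof. exact: measure_ge0. Qed.

Let rV_measureS_sigma_additive : semi_sigma_additive rV_measureS.
Proof.
exact: (@measure_semi_sigma_additive _ _ _
  (measure_function_pushforward__canonical__measure_function_Measure
     (@lebesgue_measure R \x mu) mcons)).
Qed.

HB.instance Definition _ := isMeasure.Build _ _ _ rV_measureS
  rV_measureS0 rV_measureS_ge0 rV_measureS_sigma_additive.

Let rV_measureS_sigma_finite : sigma_finite setT rV_measureS.
Proof.
have [F TF Foo] : sigma_finite setT (@lebesgue_measure R \x mu).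
  have /sigma_finiteP[F [TF ndF Foo]] := sigma_finiteT (@lebesgue_measure R).
  have /sigma_finiteP[G [TG ndG Goo]] := sigma_finiteT mu.
  exists (fun n => F n `*` G n).
    rewrite -setXTT TF TG predeqE => -[x y]; split; last first.
      by move=> [k _ []/= ? ?]; split; exists k.
    move=> [/= [j _ Fjx] [k _ Gky]]; exists (maxn j k) => //; split.
      by move: x Fjx; exact/subsetPset/ndF/leq_maxl.
    by move: y Gky; exact/subsetPset/ndG/leq_maxr.
  move=> k; have [? ?] := Foo k; have [? ?] := Goo k.
  split; first exact: measurableX.
  by rewrite product_measure1E// lte_mul_pinfty// ge0_fin_numE.
exists (fun k => @rV_uncons R n @^-1` F k).
  by rewrite -preimage_bigcup -TF preimage_setT.
move=> k; have [mFk Fkoo] := Foo k; split.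
  by rewrite -[X in measurable X]setTI; exact: measurable_rV_uncons.
rewrite /rV_measureS /pushforward -comp_preimage.
by rewrite (_ : _ \o _ = id) ?preimage_id//; apply/funext; exact: rV_consK.
Qed.

HB.instance Definition _ := Measure_isSigmaFinite.Build _ _ _ rV_measureS
  rV_measureS_sigma_finite.

End rV_measureS.

(* On R^0 = {0} the unit mass, on R^(n+1) the product measure, transported by
   R x R^n ~ R^(n+1). *)
Fixpoint borel_lebesgue (R : realType) (n : nat) :
    {sigma_finite_measure set 'rV[R]_n -> \bar R} :=
  match n with
  | 0 => \d_(0 : 'rV[R]_0)
  | n'.+1 => rV_measureS (borel_lebesgue R n')
  end.

Lemma borel_lebesgue_box (R : realType) (n : nat) (a b : 'rV[R]_n) :
  (forall i, a ord0 i <= b ord0 i) ->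
  borel_lebesgue R n [set x : 'rV[R]_n | forall i, x ord0 i \in `]a ord0 i, b ord0 i]] =
  (\prod_(i < n) (b ord0 i - a ord0 i))%:E.
Proof.
elim: n a b => [|n IHn] a b ab /=.
  rewrite big_ord0 diracE mem_set//=; by case.
rewrite /rV_measureS /pushforward big_ord_recl EFinM.
have := IHn (\row_j a ord0 (lift ord0 j)) (\row_j b ord0 (lift ord0 j)).
have -> : \prod_(i < n) ((\row_j b ord0 (lift ord0 j)) ord0 i -
   (\row_j a ord0 (lift ord0 j)) ord0 i) =
   \prod_(i < n) (b ord0 (lift ord0 i) - a ord0 (lift ord0 i)).
  by apply: eq_bigr => i _; rewrite !mxE.
set B := [set x : 'rV[R]_n | _] => <-; last by move=> i; rewrite !mxE.
have mB : measurable B.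
  rewrite (_ : B = \bigcap_(i in [set: 'I_n]) [set x : 'rV[R]_n |
    x ord0 i \in `]a ord0 (lift ord0 i), b ord0 (lift ord0 i)]]).
    apply: fin_bigcap_measurable => // i _.
    rewrite -[X in measurable X]setTI.
    exact: (@measurable_rV_coord R n i measurableT
      [set` `]a ord0 (lift ord0 i), b ord0 (lift ord0 i)]]).
  rewrite /B predeqE => x; split => [+ i _|+ i] => /(_ i);
    [rewrite /= !mxE//|move=> /(_ I); rewrite /= !mxE//].
transitivity ((@lebesgue_measure R \x borel_lebesgue R n)%E
   ([set` `]a ord0 ord0, b ord0 ord0]] `*` B)); last first.
  rewrite product_measure1E//; congr (_ * _)%E.
  rewrite [LHS]lebesgue_measure_itv/= lte_fin; case: ltP => // ba.
  by rewrite (_ : b ord0 ord0 = a ord0 ord0) ?subrr//; apply/eqP; rewrite eq_le ba ab.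
congr product_measure1; rewrite predeqE => -[t x]; split => /=.
  move=> H; split; first by have := H ord0; rewrite mxE unlift_none.
  by move=> i; have := H (lift ord0 i); rewrite !mxE liftK.
by move=> [H1 H2] i; rewrite mxE; case: unliftP => [j ->|->] //=; have := H2 j; rewrite !mxE.
Qed.

(* Lebesgue measurable sets of R^n (Caratheodory) and the complete Lebesgue
   measure on them. *)
Definition lebesgue_measurable (R : realType) (n : nat) (A : set 'rV[R]_n) : Prop :=
  ((borel_lebesgue R n)^*)%mu.-cara.-measurable A.

Definition lebesgue_rV (R : realType) (n : nat) :=
  @completed_measure_extension _ _ R (borel_lebesgue R n).
Arguments lebesgue_rV : clear implicits.

HB.instance Definition _ (R : realType) (n : nat) := Measure.on (lebesgue_rV R n).

Lemma borel_lebesgue_measurable (R : realType) (n : nat) (A : set 'rV[R]_n) :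
  measurable A -> lebesgue_measurable A.
Proof. by move=> mA; exact: caratheodory_measurable_mu_ext. Qed.

Lemma lebesgue_rVE (R : realType) (n : nat) (A : set 'rV[R]_n) :
  measurable A -> lebesgue_rV R n A = borel_lebesgue R n A.
Proof. by move=> mA; exact: measurable_mu_extE. Qed.

Section perimeter.
Variables (R : realType) (n : nat).
Implicit Types (A B Omega : set 'rV[R]_n) (phi : 'rV[R]_n -> 'rV[R]_n).

(* The library norm `|x| on 'rV[R]_n is the sup norm. *)
Definition enorm (x : 'rV[R]_n) : R := Num.sqrt (\sum_(i < n) x ord0 i ^+ 2).

Definition eball_open (c : 'rV[R]_n) (r : R) : set 'rV[R]_n :=
  [set x : 'rV[R]_n | enorm (x - c) < r].

Definition eball_closed (c : 'rV[R]_n) (r : R) : set 'rV[R]_n :=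
  [set x : 'rV[R]_n | enorm (x - c) <= r].

Definition is_eball (r : R) B : Prop :=
  exists c, B = eball_open c r \/ B = eball_closed c r.

Definition C1 phi : Prop :=
  (forall x, differentiable phi x) /\ continuous (jacobian phi).

Definition compactly_supported phi : Prop :=
  compact (closure [set x : 'rV[R]_n | phi x != 0]).

Definition divergence phi (x : 'rV[R]_n) : R :=
  \sum_(i < n) 'D_(delta_mx ord0 i) (fun y => phi y ord0 i) x.

(* Total variation of the characteristic function of A; the integrands are
   continuous with compact support, hence integrable. *)
Definition perimeter A : \bar R :=
  ereal_sup [set (\int[lebesgue_rV R n]_(x in A) (divergence phi x)%:E)%E |
    phi in [set phi | [/\ C1 phi, compactly_supported phi &
                          forall x, enorm (phi x) <= 1]]].

Definition energy (lambda : R) Omega A : \bar R :=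
  (perimeter A + lambda%:E * lebesgue_rV R n (A `+` Omega))%E.

Definition is_minimizer (lambda : R) Omega A : Prop :=
  lebesgue_measurable A /\
  forall A', lebesgue_measurable A' ->
    (energy lambda Omega A <= energy lambda Omega A')%E.

End perimeter.

(* Main.v *)
Require Import Defs.
From mathcomp Require Import all_boot all_order all_algebra.
From mathcomp Require Import all_classical all_reals all_analysis.
From mathcomp Require Import measurable_realfun ring lra.
Set Implicit Arguments.
Unset Strict Implicit.
Unset Printing Implicit Defensive.
Import Order.TTheory GRing.Theory Num.Theory.
Import numFieldNormedType.Exports.
Local Open Scope classical_set_scope.
Local Open Scope ring_scope.

(* Everything reduces to
     Per(B U S) <= Per(S) + (n/r) |B \ S|   for a ball B of radius r and S measurable:
   since n/r = lambda, this is E(B U Sigma) <= E(Sigma) when B is contained in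
   Omega, and applied to the complement of Sigma it gives the second claim.
   The inequality is a calibration argument. Given a test field phi for B U S, let
   psi be phi outside B and (x - c)/r, which has divergence n/r, inside B. The
   outward normal component of psi drops across the sphere, so the singular part of
   div psi is nonpositive and the integral of div psi over the complement of S is at
   most (n/r) |B \ S| plus that of div phi over the complement of B U S; as
   divergences of compactly supported fields have zero mean, this compares the flux
   of phi through B U S with that of psi through S. To stay within C^1 fields, psi is replaced by psi_k = phi + eta_k ((x - c)/r - phi), where
   eta_k = 1 - (1 - u^2)^(k+1) and u = max(1 - |x - c|^2/r^2, 0); the error in the
   divergence is at most (2/r)(k+1) u^2 (1 - u^2)^k, which is bounded and tends to 0
   pointwise, so dominated convergence applies. *)

(** * Measurability of continuous functions and transfer to the completion *)

Section continuous_measurable.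
Variables (R : realType) (n : nat).

Lemma measurable_rV_ball (x : 'rV[R]_n) (e : R) :
  0 < e -> measurable [set y : 'rV[R]_n | forall i, `|x ord0 i - y ord0 i| < e].
Proof.
move=> e0.
rewrite (_ : mkset _ = \bigcap_(i in [set: 'I_n])
    [set y : 'rV[R]_n | `|x ord0 i - y ord0 i| < e]); last first.
  by apply/seteqP; split=> [y H i _|y H i]; [exact: H|exact: (H i I)].
apply: fin_bigcap_measurable => // i _.
rewrite -[X in measurable X]setTI.
apply: (@measurable_rV_coord R n i measurableT [set t | `|x ord0 i - t| < e]).
rewrite (_ : mkset _ = ball (x ord0 i) e) //.
by apply: open_measurable; exact: ball_open.
Qed.

(** The coordinate cylinders generate the full Borel sigma-algebra: an open set is the union of the
    countably many open cubes with rational centre and rational half-side that it contains. *)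
Lemma open_measurable_rV (U : set 'rV[R]_n) : open U -> measurable U.
Proof.
move=> oU.
pose S (p : 'rV[rat]_n * rat) : set 'rV[R]_n :=
  [set y | forall i, `|ratr (p.1 ord0 i) - y ord0 i| < ratr p.2].
pose F p := if `[< 0 < p.2 /\ S p `<=` U >] then S p else set0.
suff -> : U = \bigcup_p F p.
  apply: countable_bigcupT_measurable => [|p]; [exact: countableP|rewrite /F].
  case: asboolP => // -[p0 _].
  have := @measurable_rV_ball (\row_i ratr (p.1 ord0 i)) (ratr p.2).
  rewrite ltr0q => /(_ p0); congr measurable.
  by apply/seteqP; split => y H i; have := H i; rewrite mxE.
apply/seteqP; split=> [x Ux|x [p _]]; last first.
  by rewrite /F; case: asboolP => // -[_ +] Sx; exact.
have /nbhs_ballP[e /= e0 xeU] : nbhs x U by exact: open_nbhs_nbhs.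
(* Two points of a cube of half-side below e / 2 are less than e apart in each coordinate, so a cube
   around x of this size stays in the ball of radius e. *)
have [q] : exists q, ratr q \in `]0, (e / 2)[ by apply: rat_in_itvoo; rewrite divr_gt0.
rewrite in_itv /= ltr0q => /andP[q0 qe].
have H (i : 'I_n) : exists s : rat, `|ratr s - x ord0 i| < ratr q.
  have [s] : exists s, ratr s \in `](x ord0 i - ratr q), (x ord0 i + ratr q)[.
    by apply: rat_in_itvoo; have : 0 < ratr q :> R by [rewrite ltr0q]; lra.
  rewrite in_itv /= => /andP[a b]; exists s.
  by rewrite ltr_norml; apply/andP; split; lra.
have [s Hs] := choice H.
exists (\row_i s i, q) => //; rewrite /F.
have xS : S (\row_i s i, q) x by move=> i; rewrite /= mxE.
rewrite asboolT //; split=> //= y Hy; apply: xeU.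
split=> // i j; rewrite ord1 /ball /=.
have := Hs j; have := Hy j; rewrite /= mxE.
move: (ratr (s j)) (x ord0 j) (y ord0 j) => a b c.
rewrite !ltr_norml; move=> /andP[? ?] /andP[? ?]; apply/andP; split; lra.
Qed.

Lemma closed_measurable_rV (A : set 'rV[R]_n) : closed A -> measurable A.
Proof.
by move=> /closed_openC/open_measurable_rV/measurableC; rewrite setCK.
Qed.

Lemma continuous_measurable_rV (f : 'rV[R]_n -> R) :
  continuous f -> measurable_fun setT f.
Proof.
move=> cf; apply: (measurability _ (RGenOpens.measurableE R)).
move=> _ [_ [a [b ->]] <-]; rewrite setTI; apply: open_measurable_rV.
by apply: open_comp => //; exact: interval_open.
Qed.

End continuous_measurable.

(** * Integrals along measure-preserving maps *)

Section measure_preserving.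
Context d d' (X : measurableType d) (Y : measurableType d') (R : realType).
Variables (p : X -> Y) (mp : measurable_fun setT p).
Variables (mu : {measure set X -> \bar R}) (nu : {measure set Y -> \bar R}).
Hypothesis mu_nu : forall A, measurable A -> mu (p @^-1` A) = nu A.
Variable (f : Y -> \bar R).
Hypothesis If : nu.-integrable setT f.

Let mf : measurable_fun setT f. Proof. exact: measurable_int If. Qed.

Lemma integrable_measure_preserving : mu.-integrable setT (f \o p).
Proof.
apply/integrableP; split; first exact: measurableT_comp.
move/integrableP: If => [_]; apply: le_lt_trans.
rewrite -(@eq_measure_integral _ _ _ _ _ (pushforward mu p)); last first.
  by move=> A mA _; exact: mu_nu.
by rewrite (ge0_integral_pushforward mp)//; exact: measurableT_comp.
Qed.

(** Serves two maps: the identity from the completed to the Borel measure space, and the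
    identification [rV_cons] of R x R^n with R^(n+1). *)
Lemma integral_measure_preserving : (\int[mu]_x (f \o p) x = \int[nu]_x f x)%E.
Proof.
rewrite -[RHS](@eq_measure_integral _ _ _ _ _ (pushforward mu p)); last first.
  by move=> A mA _; exact: mu_nu.
by rewrite (integral_pushforward mp)//; exact: integrable_measure_preserving.
Qed.

End measure_preserving.

Section completed.
Variables (R : realType) (n : nat).
Local Notation mu := (lebesgue_rV R n).
Local Notation nu := (borel_lebesgue R n).
Local Notation T := (caratheodory_type (nu^*)%mu).

(** Source and target have the same points, but the source carries the larger Caratheodory
    sigma-algebra. *)
Lemma measurable_completion_id : measurable_fun [set: T] (id : T -> 'rV[R]_n).
Proof. by move=> _ A mA; rewrite setTI; exact: borel_lebesgue_measurable. Qed.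

Lemma measurable_completed d (Y : measurableType d) (f : 'rV[R]_n -> Y) :
  measurable_fun setT f -> measurable_fun [set: T] (f : T -> Y).
Proof. by move=> mf; exact: (measurableT_comp mf measurable_completion_id). Qed.

(** Moves the integrals that define [perimeter] to the Borel measure, which is built from product
    measures and so admits Fubini. *)
Lemma integral_completed (f : 'rV[R]_n -> \bar R) :
  nu.-integrable setT f -> (\int[mu]_x f x = \int[nu]_x f x)%E.
Proof.
move=> If.
exact: (@integral_measure_preserving _ _ _ _ _ _ measurable_completion_id mu nu
  (@lebesgue_rVE R n)).
Qed.

End completed.

(** * Functions supported in a box *)

Lemma continuous_mx (T : topologicalType) (R : realType) m n
    (f : T -> 'M[R]_(m, n)) :
  (forall i j, continuous (fun x => f x i j)) -> continuous f.
Proof.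
move=> cf x A [P Px PA].
have : \forall y \near x, forall i j, P i j (f y i j).
  by apply: filter_forall => i; apply: filter_forall => j; exact: (cf i j x _ (Px i j)).
by apply: filterS => y; exact: PA.
Qed.

Section box.
Variables (R : realType) (n : nat).

(** Supports are enclosed in cubes because the slices of a cube are again cubes, which suits
    induction on the dimension. *)
Definition box (M : R) : set 'rV[R]_n :=
  [set x : 'rV[R]_n | forall i, x ord0 i \in `[- M, M]].

Lemma compact_box (M : R) : compact (box M).
Proof.
apply: (@rV_compact R n (fun=> `[- M, M]%classic)).
by move=> _; exact: segment_compact.
Qed.

Lemma measurable_box (M : R) : measurable (box M).
Proof.
apply: closed_measurable_rV; apply: compact_closed; last exact: compact_box.
exact: norm_hausdorff.
Qed.

Lemma borel_lebesgue_box_lty (M : R) : (borel_lebesgue R n (box M) < +oo)%E.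
Proof.
(* [borel_lebesgue_box] measures half-open boxes, hence the margin 1 on the left below; the absolute
   value keeps the sides nonnegative when M < 0. *)
pose N := `|M|.
apply: (@le_lt_trans _ _ (borel_lebesgue R n [set x : 'rV[R]_n |
    forall i, x ord0 i \in `](\row_(j < n) (- (N + 1))) ord0 i,
                             (\row_(j < n) N) ord0 i]])); last first.
  rewrite borel_lebesgue_box ?ltry// => i; rewrite !mxE.
  have : 0 <= N by exact: normr_ge0.
  lra.
apply: le_measure; rewrite ?inE.
- exact: measurable_box.
- rewrite (_ : mkset _ = \bigcap_(i in [set: 'I_n])
    [set x : 'rV[R]_n | x ord0 i \in `](- (N + 1)), N]]).
    apply: fin_bigcap_measurable => // i _.
    rewrite -[X in measurable X]setTI.
    exact: (@measurable_rV_coord R n i measurableT [set` `](- (N + 1)), N]]).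
  rewrite predeqE => x; split => [+ i _|+ i] => /(_ i); first by rewrite /= !mxE.
  by move=> /(_ I); rewrite /= !mxE.
- move=> x Bx i; have := Bx i; rewrite !mxE !in_itv/= => /andP[? ?].
  have : M <= N by exact: ler_norm.
  by move=> ?; apply/andP; split; lra.
Qed.

Lemma continuous_box_bounded (g : 'rV[R]_n -> R) (M : R) :
  continuous g -> exists C, forall x, box M x -> `|g x| <= C.
Proof.
move=> cg.
have : compact (g @` box M).
  apply: continuous_compact; last exact: compact_box.
  exact: continuous_subspaceT.
move=> /compact_bounded[N [_ HN]].
exists (N + 1) => x Bx; apply: (HN (N + 1)); first by rewrite ltrDl.
by exists x.
Qed.

Lemma integrable_box (g : 'rV[R]_n -> R) (M : R) :
  continuous g -> (forall x, ~ box M x -> g x = 0) ->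
  (borel_lebesgue R n).-integrable setT (EFin \o g).
Proof.
move=> cg g0.
rewrite (_ : EFin \o g = (EFin \o g) \_ (box M)); last first.
  apply/funext => x; rewrite /patch; case: ifPn => //.
  by rewrite notin_setE => /g0 /= ->.
apply/(integrable_mkcond _ (measurable_box M)).
apply: measurable_bounded_integrable.
- exact: measurable_box.
- exact: borel_lebesgue_box_lty.
- by apply: measurable_funTS; exact: continuous_measurable_rV.
- have [C HC] := continuous_box_bounded M cg.
  exists C; split; first exact: num_real.
  by move=> D CD x /= Bx; rewrite (le_trans (HC _ Bx))// ltW.
Qed.

End box.

(** * Partial derivatives have zero integral *)

Lemma integral_derive_eq0 (R : realType) (F G : R -> R) (M : R) :
  (forall t : R, is_derive t 1 F (G t)) -> continuous G ->
  (forall t : R, ~ t \in `[- M, M] -> F t = 0) ->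
  (forall t : R, ~ t \in `[- M, M] -> G t = 0) ->
  (\int[@lebesgue_measure R]_t (G t)%:E = 0)%E.
Proof.
move=> dF cG F0 G0.
(* N > M makes F vanish at both endpoints of the interval, so the fundamental theorem of calculus
   gives 0; N > 0 makes the interval nondegenerate. *)
pose N : R := `|M| + 1.
have N0 : 0 < N by rewrite ltr_pwDr.
have MN : M < N by rewrite (le_lt_trans (ler_norm M))// ltrDl.
have cF : continuous F.
  move=> t; apply: differentiable_continuous; apply/derivable1_diffP.
  exact: ex_derive.
transitivity (\int[@lebesgue_measure R]_(t in `[(- N)%R, N]) (G t)%:E)%E.
  rewrite [RHS]integral_mkcond; apply: eq_integral => t _.
  rewrite /patch; case: ifPn => //; rewrite notin_setE /= => tN.
  rewrite G0 //; apply: contra_not tN.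
  by rewrite !in_itv /= => /andP[? ?]; apply/andP; split; lra.
rewrite (@continuous_FTC2 _ G F).
- rewrite !F0 ?subee// in_itv /= => /andP[? ?]; lra.
- lra.
- exact: continuous_subspaceT.
- split; [by move=> t _; exact: ex_derive| |].
    by apply: cvg_at_right_filter; exact: cF.
  by apply: cvg_at_left_filter; exact: cF.
- by move=> t _; rewrite derive1E; exact: derive_val.
Qed.

(** * Slicing along the first coordinate *)

Section rV_cons_calculus.
Variables (R : realType) (n : nat).

Lemma rV_cons0 (t : R) (y : 'rV[R]_n) : rV_cons (t, y) ord0 ord0 = t.
Proof. by rewrite mxE unlift_none. Qed.

Lemma rV_consS (t : R) (y : 'rV[R]_n) j : rV_cons (t, y) ord0 (lift ord0 j) = y ord0 j.
Proof. by rewrite mxE liftK. Qed.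

(** Matches the argument h v + x of the difference quotients, so that derivatives along slices are
    partial derivatives. *)
Lemma rV_consD (h t s : R) (u y : 'rV[R]_n) :
  rV_cons (h * s + t, h *: u + y) = h *: rV_cons (s, u) + rV_cons (t, y).
Proof.
apply/rowP => i; rewrite !mxE; case: unliftP => [j _|_] //=.
by rewrite !mxE.
Qed.

Lemma delta_rV_cons0 : delta_mx ord0 ord0 = rV_cons (1 : R, 0 : 'rV[R]_n).
Proof. by apply/rowP => i; rewrite !mxE; case: unliftP => [j ->|->] //=; rewrite mxE. Qed.

Lemma delta_rV_consS (j : 'I_n) :
  delta_mx ord0 (lift ord0 j) = rV_cons (0 : R, delta_mx ord0 j : 'rV[R]_n).
Proof.
apply/rowP => i; rewrite !mxE /=; case: unliftP => [k ->|->] //=.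
by rewrite mxE (inj_eq lift_inj).
Qed.

Lemma is_derive_rV_cons0 (f : 'rV[R]_n.+1 -> R) (t : R) y d :
  is_derive (rV_cons (t, y)) (delta_mx ord0 ord0) f d ->
  is_derive t 1 (fun t => f (rV_cons (t, y))) d.
Proof.
have E : (fun h : R => h^-1 *: (f (rV_cons (h *: 1 + t, y)) - f (rV_cons (t, y)))) =
  (fun h : R => h^-1 *: (f (h *: delta_mx ord0 ord0 + rV_cons (t, y)) - f (rV_cons (t, y)))).
  apply/funext => h; congr (_ *: (f _ - _)).
  by rewrite delta_rV_cons0 -rV_consD scaler0 add0r.
by move=> [df vf]; split; rewrite /derivable /derive /= ?E.
Qed.

Lemma is_derive_rV_consS (f : 'rV[R]_n.+1 -> R) (t : R) y j d :
  is_derive (rV_cons (t, y)) (delta_mx ord0 (lift ord0 j)) f d ->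
  is_derive y (delta_mx ord0 j) (fun y => f (rV_cons (t, y))) d.
Proof.
have E : (fun h : R =>
    h^-1 *: (f (rV_cons (t, h *: delta_mx ord0 j + y)) - f (rV_cons (t, y)))) =
  (fun h : R => h^-1 *:
    (f (h *: delta_mx ord0 (lift ord0 j) + rV_cons (t, y)) - f (rV_cons (t, y)))).
  apply/funext => h; congr (_ *: (f _ - _)).
  by rewrite delta_rV_consS -rV_consD mulr0 add0r.
by move=> [df vf]; split; rewrite /derivable /derive /= ?E.
Qed.

Lemma continuous_rV_cons0 (y : 'rV[R]_n) : continuous (fun t : R => rV_cons (t, y)).
Proof.
apply: continuous_mx => i k; rewrite ord1.
case: (unliftP ord0 k) => [j ->|->].
  by under eq_fun do rewrite rV_consS; exact: cst_continuous.
by under eq_fun do rewrite rV_cons0; move=> t; exact: cvg_id.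
Qed.

Lemma continuous_rV_consS (t : R) : continuous (fun y : 'rV[R]_n => rV_cons (t, y)).
Proof.
apply: continuous_mx => i k; rewrite ord1.
case: (unliftP ord0 k) => [j ->|->].
  by under eq_fun do rewrite rV_consS; exact: coord_continuous.
by under eq_fun do rewrite rV_cons0; exact: cst_continuous.
Qed.

Lemma box_rV_cons M (t : R) (y : 'rV[R]_n) :
  box M (rV_cons (t, y)) <-> t \in `[- M, M] /\ box M y.
Proof.
split=> [H|[tM yM] k].
  split; first by have := H ord0; rewrite rV_cons0.
  by move=> j; have := H (lift ord0 j); rewrite rV_consS.
by case: (unliftP ord0 k) => [j ->|->]; rewrite ?rV_consS ?rV_cons0.
Qed.

End rV_cons_calculus.

(** Induction on the dimension by Fubini. If i is a later coordinate, the inner integral runs over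
    R^n and vanishes by induction; if i is the first one, the inner integral is one-dimensional and
    vanishes by the fundamental theorem of calculus. *)
Lemma integral_partial_eq0 (R : realType) n (i : 'I_n) (f g : 'rV[R]_n -> R) (M : R) :
  (forall x, is_derive x (delta_mx ord0 i) f (g x)) -> continuous g ->
  (forall x, ~ box M x -> f x = 0) -> (forall x, ~ box M x -> g x = 0) ->
  (\int[borel_lebesgue R n]_x (g x)%:E = 0)%E.
Proof.
elim: n i f g => [[]//|n IH] i f g dg cg f0 g0.
have Ig := integrable_box cg g0.
pose cons : measurableTypeR R * 'rV[R]_n -> 'rV[R]_n.+1 := @rV_cons R n.
have mcons : measurable_fun setT cons by exact: measurable_rV_cons.
pose nu := (@lebesgue_measure R \x borel_lebesgue R n)%E.
have E A : measurable A -> nu (cons @^-1` A) = borel_lebesgue R n.+1 A by [].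
rewrite -(integral_measure_preserving mcons E Ig).
have Ic := integrable_measure_preserving mcons E Ig.
case: (unliftP ord0 i) dg => [j ->|->] dg.
  rewrite -integral12_prod_meas1//.
  apply: integral0_eq => t _; rewrite /fubini_F /=.
  apply: (IH j (fun y => f (cons (t, y))) (fun y => g (cons (t, y)))).
  - by move=> y; exact: is_derive_rV_consS.
  - move=> y; apply: continuous_comp; [exact: continuous_rV_consS|exact: cg].
  - by move=> y yM; apply: f0 => /box_rV_cons[].
  - by move=> y yM; apply: g0 => /box_rV_cons[].
rewrite -integral21_prod_meas1//.
apply: integral0_eq => y _; rewrite /fubini_G /=.
apply: (@integral_derive_eq0 R (fun t => f (cons (t, y))) (fun t => g (cons (t, y))) M).
- by move=> t; exact: is_derive_rV_cons0.
- move=> t; apply: continuous_comp; [exact: continuous_rV_cons0|exact: cg].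
- by move=> t tM; apply: f0 => /box_rV_cons[].
- by move=> t tM; apply: g0 => /box_rV_cons[].
Qed.

(** Tonelli applied to the indicator of A: its inner integral over each line parallel to the first
    axis is the length of a countable set. *)
Lemma borel_lebesgue_countable_sections (R : realType) n (A : set 'rV[R]_n.+1) :
  measurable A -> (forall y, countable [set t | A (rV_cons (t, y))]) ->
  borel_lebesgue R n.+1 A = 0%E.
Proof.
move=> mA cA.
pose cons : measurableTypeR R * 'rV[R]_n -> 'rV[R]_n.+1 := @rV_cons R n.
have mcA : measurable (cons @^-1` A).
  by rewrite -[X in measurable X]setTI; exact: measurable_rV_cons.
transitivity ((@lebesgue_measure R \x borel_lebesgue R n)%E (cons @^-1` A)) => //.
rewrite -[LHS]mul1e -integral_cst//.
rewrite integral_mkcond fubini_tonelli2.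
- apply: integral0_eq => y _; rewrite /fubini_G /=.
  pose B := [set t | A (rV_cons (t, y))].
  have mB : measurable B by exact: (countable_measurable _ (cA y)).
  transitivity (\int[@lebesgue_measure R]_(t in B) (cst 1 t))%E.
    by rewrite [RHS]integral_mkcond; apply: eq_integral => t _.
  rewrite integral_cst// [X in (_ * X)%E](_ : _ = 0%E) ?mule0//.
  by apply: countable_lebesgue_measure0; exact: cA.
- apply/(measurable_restrictT _ _).1 => //; exact: measurable_cst.
- by move=> z; apply: erestrict_ge0.
Qed.

(** * Coordinatewise calculus *)

Section continuous_real_functions.
Variables (R : realType) (T : topologicalType).
Implicit Types f g : T -> R.

Lemma continuous_addf f g : continuous f -> continuous g ->
  continuous (fun x => f x + g x).
Proof. by move=> cf cg x; apply: cvgD; [exact: cf|exact: cg]. Qed.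

Lemma continuous_subf f g : continuous f -> continuous g ->
  continuous (fun x => f x - g x).
Proof. by move=> cf cg x; apply: cvgB; [exact: cf|exact: cg]. Qed.

Lemma continuous_mulf f g : continuous f -> continuous g ->
  continuous (fun x => f x * g x).
Proof. by move=> cf cg x; apply: cvgM; [exact: cf|exact: cg]. Qed.

Lemma continuous_expf f k : continuous f -> continuous (fun x => f x ^+ k).
Proof.
move=> cf; elim: k => [|k IH]; first exact: cst_continuous.
by under eq_fun do rewrite exprS; exact: continuous_mulf.
Qed.

Lemma continuous_sumf (I : Type) (s : seq I) (f : I -> T -> R) :
  (forall i, continuous (f i)) -> continuous (fun x => \sum_(i <- s) f i x).
Proof.
move=> cf; elim: s => [|i s IH].
  by under eq_fun do rewrite big_nil; exact: cst_continuous.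
by under eq_fun do rewrite big_cons; exact: continuous_addf.
Qed.

End continuous_real_functions.

Section C1_coordinates.
Variables (R : realType) (n : nat).
Implicit Type phi : 'rV[R]_n -> 'rV[R]_n.

Lemma jacobianE phi x i j : differentiable phi x ->
  jacobian phi x i j = 'D_(delta_mx ord0 i) (fun y => phi y ord0 j) x.
Proof.
move=> dphi; rewrite /jacobian mxE -deriveE// derive_mx ?mxE//.
exact: diff_derivable.
Qed.

Lemma differentiable_rV_coord phi x j :
  differentiable phi x -> differentiable (fun y => phi y ord0 j) x.
Proof.
move=> dphi; apply: (@differentiable_comp _ _ _ _ phi (fun M : 'rV[R]_n => M ord0 j)) => //.
exact: differentiable_coord.
Qed.

Lemma differentiable_rV phi x :
  (forall j, differentiable (fun y => phi y ord0 j) x) -> differentiable phi x.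
Proof.
move=> dphi.
rewrite (_ : phi = \sum_(j < n) (fun y => phi y ord0 j *: delta_mx ord0 j)).
  by apply: differentiable_sum => j; exact: differentiableZl.
apply/funext => y; rewrite fct_sumE; exact: row_sum_delta.
Qed.

(** The entries of the Jacobian are the partial derivatives of the components, so C^1 regularity can
    be checked with the calculus of scalar functions. *)
Lemma C1P phi : C1 phi <->
  (forall j x, differentiable (fun y => phi y ord0 j) x) /\
  (forall i j, continuous ('D_(delta_mx ord0 i) (fun y => phi y ord0 j))).
Proof.
split=> [[dphi cphi]|[dphi cphi]].
  split=> [j x|i j]; first exact: differentiable_rV_coord.
  rewrite (_ : 'D_ _ _ = (fun x => jacobian phi x i j)); last first.
    by apply/funext => x; rewrite jacobianE.
  move=> x; apply: (@continuous_comp _ _ _ (jacobian phi) (fun M : 'M[R]_n => M i j)).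
    exact: cphi.
  exact: coord_continuous.
have dphi' x : differentiable phi x by exact: differentiable_rV.
split=> //; apply: continuous_mx => i j.
by under eq_fun do rewrite jacobianE//; exact: cphi.
Qed.

End C1_coordinates.

Lemma is_derive_comp_real (R : realType) (V : normedModType R) (f : V -> R)
    (h : R -> R) x v df dh :
  differentiable f x -> is_derive x v f df -> is_derive (f x) 1 h dh ->
  is_derive x v (h \o f) (dh * df).
Proof.
move=> Df [_ <-] [Dh <-].
have Dh' : differentiable h (f x) by exact/derivable1_diffP.
split; first by apply: diff_derivable; exact: differentiable_comp.
rewrite !deriveE//; last exact: differentiable_comp.
rewrite diff_comp// /= deriv1E// derive1E deriveE//.
by rewrite scale1r mulrC.
Qed.

(** * The cutoff profile *)

Section cutoff_profile.
Variable R : realType.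

(** Squaring smooths the kink of the positive part: the difference quotient with increment h is
    within |h| of the derivative. *)
Lemma is_derive_max0_sqr (s : R) :
  is_derive s 1 (fun t => Num.max t 0 ^+ 2) (2 * Num.max s 0).
Proof.
have cv : (fun h : R => h^-1 *: (Num.max (h *: 1 + s) 0 ^+ 2 - Num.max s 0 ^+ 2))
    @ 0^' --> 2 * Num.max s 0.
  apply/cvgrPdist_le => e e0; near=> h.
  have h0 : h != 0 by near: h; exact: nbhs_dnbhs_neq.
  have he : `|h| <= e.
    near: h; apply: nbhs_dnbhs; apply/nbhs_ballP; exists e => //= h.
    by rewrite /ball /= sub0r normrN => /ltW.
  apply: le_trans he.
  (* After multiplication by |h| the error is to be bounded by h^2, which is checked according to
     the signs of s and h + s. *)
  rewrite -(ler_pM2r (_ : 0 < `|h|)) ?normr_gt0// -normrM mulrBl.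
  rewrite [h^-1 *: _ * h]mulrC mulrA mulfV// mul1r -normrM.
  rewrite [h *: 1]mulr1.
  rewrite [leRHS]ger0_norm ?sqr_ge0// ler_norml.
  by case: (leP s 0) => s0; case: (leP (h + s) 0) => hs0; apply/andP; split; nra.
by split; [apply/cvg_ex; exists (2 * Num.max s 0)|exact/cvg_lim].
Unshelve. all: by end_near. Qed.

(** This is eta_k as a function of the depth s. It vanishes for s <= 0 and equals 1 at s = 1, the
    centre of the ball; the square makes its slope vanish at s = 0, so that it is C^1 across the
    sphere. *)
Definition profile k (s : R) : R := 1 - (1 - Num.max s 0 ^+ 2) ^+ k.+1.
Definition dprofile k (s : R) : R :=
  k.+1%:R * (1 - Num.max s 0 ^+ 2) ^+ k * (2 * Num.max s 0).

Lemma is_derive_profile k (s : R) : is_derive s 1 (profile k) (dprofile k s).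
Proof.
pose q : R -> R := fun t => Num.max t 0 ^+ 2.
have dq : is_derive (s : R) 1 q (2 * Num.max s 0) by exact: is_derive_max0_sqr.
rewrite (_ : profile k = cst 1 - (cst 1 - q) ^+ k.+1); last first.
  by apply/funext => t; rewrite /profile /q !fctE.
apply: is_derive_eq; rewrite /dprofile !fctE /q /=.
by rewrite !sub0r scalerN opprK -[LHS]/(_ * _).
Qed.

Lemma continuous_max0 : continuous (fun s : R => Num.max s 0).
Proof. by move=> s; apply: continuous_max; [exact: cvg_id|exact: cvg_cst]. Qed.

Lemma continuous_dprofile k : continuous (dprofile k).
Proof.
apply: continuous_mulf; last first.
  by apply: continuous_mulf; [exact: cst_continuous|exact: continuous_max0].
apply: continuous_mulf; first exact: cst_continuous.
apply: continuous_expf; apply: continuous_subf; first exact: cst_continuous.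
by apply: continuous_expf; exact: continuous_max0.
Qed.

End cutoff_profile.

(** * The calibrating fields *)

Section calibration.
Variables (R : realType) (n : nat) (c : 'rV[R]_n) (r : R).
Hypothesis r0 : 0 < r.
Implicit Types (x : 'rV[R]_n) (phi : 'rV[R]_n -> 'rV[R]_n).

Local Notation e_ i := (delta_mx ord0 i : 'rV[R]_n).

Definition sqdist x : R := \sum_(i < n) (x ord0 i - c ord0 i) ^+ 2.

(** Positive inside the ball, zero on the sphere, negative outside. Being a polynomial in x, it is
    smooth at the centre too. *)
Definition depth x : R := 1 - sqdist x / r ^+ 2.

Definition cutoff k x : R := profile k (depth x).

(* As k grows, [cutoff k] tends to the indicator of the open ball, so that this
   interpolates between [phi] outside and the calibration (x - c)/r inside. *)
Definition calibrated k phi x : 'rV[R]_n :=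
  \row_j (phi x ord0 j + cutoff k x * ((x ord0 j - c ord0 j) / r - phi x ord0 j)).

Lemma is_derive_coord x v j : is_derive x v (fun y : 'rV[R]_n => y ord0 j) (v ord0 j).
Proof.
split; first by apply: diff_derivable; exact: differentiable_coord.
have /matrixP/(_ ord0 j) := @derive_mx R _ _ _ id x v (@derivable_id _ _ _ _).
by rewrite derive_id mxE => ->.
Qed.

(** A combination of functions, the form to which the differentiation rules for sums, differences
    and powers apply; [depthE] and [calibrated_coordE] have the same purpose. *)
Lemma sqdistE :
  sqdist = \sum_(j < n) ((fun y : 'rV[R]_n => y ord0 j) - cst (c ord0 j)) ^+ 2.
Proof. by apply/funext => y; rewrite fct_sumE. Qed.

Lemma is_derive_sqdist x i : is_derive x (e_ i) sqdist (2 * (x ord0 i - c ord0 i)).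
Proof.
rewrite sqdistE.
have dj j : is_derive x (e_ i) (fun y : 'rV[R]_n => y ord0 j) (e_ i ord0 j).
  exact: is_derive_coord.
apply: is_derive_eq.
rewrite (bigD1 i)//= big1 ?addr0; last first.
  move=> j ji; rewrite mxE (negPf ji) andbF subr0.
  by rewrite -[LHS]/(_ * _) mulr0.
by rewrite !mxE !eqxx subr0 -[LHS]/(_ * _) mulr1 expr1.
Qed.

Lemma differentiable_sqdist x : differentiable sqdist x.
Proof.
rewrite sqdistE.
apply: differentiable_sum => j; apply: differentiableX.
by apply: differentiableB => //; exact: differentiable_coord.
Qed.

Lemma depthE : depth = cst 1 - (r ^- 2) *: sqdist.
Proof. by apply/funext => y; rewrite /depth mulrC. Qed.

Lemma is_derive_depth x i :
  is_derive x (e_ i) depth (- 2 * (x ord0 i - c ord0 i) / r ^+ 2).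
Proof.
have ds := is_derive_sqdist x i.
rewrite depthE; apply: is_derive_eq.
by rewrite sub0r -[_ *: _]/(_ * _) mulNr mulNr mulrC.
Qed.

Lemma differentiable_depth x : differentiable depth x.
Proof.
rewrite depthE; apply: differentiableB => //.
by apply: differentiableZ; exact: differentiable_sqdist.
Qed.

Lemma continuous_depth : continuous depth.
Proof. by move=> x; apply: differentiable_continuous; exact: differentiable_depth. Qed.

Lemma is_derive_cutoff k x i : is_derive x (e_ i) (cutoff k)
  (dprofile k (depth x) * (- 2 * (x ord0 i - c ord0 i) / r ^+ 2)).
Proof.
apply: is_derive_comp_real.
- exact: differentiable_depth.
- exact: is_derive_depth.
- exact: is_derive_profile.
Qed.

Lemma differentiable_cutoff k x : differentiable (cutoff k) x.
Proof.
apply: (@differentiable_comp _ _ _ _ depth (profile k)).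
  exact: differentiable_depth.
by apply/derivable1_diffP; have [] := is_derive_profile k (depth x).
Qed.

Lemma continuous_cutoff k : continuous (cutoff k).
Proof. by move=> x; apply: differentiable_continuous; exact: differentiable_cutoff. Qed.

Lemma depth_le1 x : depth x <= 1.
Proof.
rewrite /depth lerBlDr lerDl divr_ge0 ?sqr_ge0//.
by apply: sumr_ge0 => i _; exact: sqr_ge0.
Qed.

Lemma cutoff_itv k x : 0 <= cutoff k x <= 1.
Proof.
have := depth_le1 x; rewrite /cutoff /profile; move: (depth x) => s s1.
have : 0 <= 1 - Num.max s 0 ^+ 2 <= 1.
  have [s0|s0] := leP s 0; first by rewrite expr0n/= subr0 ler01 lexx.
  by rewrite subr_ge0 lerBlDr lerDl sqr_ge0 andbT exprn_ile1// ltW.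
move: (1 - Num.max s 0 ^+ 2) => q /andP[q0 q1].
by rewrite subr_ge0 lerBlDr lerDl exprn_ge0// exprn_ile1.
Qed.

Lemma cutoff_eq0 k x : depth x <= 0 -> cutoff k x = 0.
Proof.
by move=> d0; rewrite /cutoff /profile max_r// expr0n/= subr0 expr1n subrr.
Qed.

Lemma enorm_le1 (v : 'rV[R]_n) : (enorm v <= 1) = (\sum_(i < n) v ord0 i ^+ 2 <= 1).
Proof. by rewrite /enorm -[X in (_ <= X) = _]sqrtr1 ler_sqrt. Qed.

Lemma enorm_sqdist x : enorm (x - c) = Num.sqrt (sqdist x).
Proof. by congr Num.sqrt; apply: eq_bigr => i _; rewrite !mxE. Qed.

Lemma eball_openE : eball_open c r = [set x | 0 < depth x].
Proof.
apply/funext => x; apply/propext; rewrite /eball_open /=.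
rewrite enorm_sqdist -{1}(gtr0_norm r0) -sqrtr_sqr ltr_sqrt ?exprn_gt0//.
by rewrite /depth subr_gt0 ltr_pdivrMr ?exprn_gt0// mul1r.
Qed.

Lemma eball_closedE : eball_closed c r = [set x | 0 <= depth x].
Proof.
apply/funext => x; apply/propext; rewrite /eball_closed /=.
rewrite enorm_sqdist -{1}(gtr0_norm r0) -sqrtr_sqr ler_sqrt ?sqr_ge0//.
by rewrite /depth subr_ge0 ler_pdivrMr ?exprn_gt0// mul1r.
Qed.

(** Where the depth is at most 0 the field is phi; elsewhere it is a convex combination of phi and
    (x - c)/r, both in the unit ball, and the squared norm is convex. *)
Lemma enorm_calibrated k phi x : enorm (phi x) <= 1 -> enorm (calibrated k phi x) <= 1.
Proof.
have [d0|d0] := leP (depth x) 0.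
  rewrite !enorm_le1; congr (_ <= _); apply: eq_bigr => i _.
  by rewrite mxE cutoff_eq0// mul0r addr0.
rewrite !enorm_le1 => phi1.
have X1 : \sum_(i < n) ((x ord0 i - c ord0 i) / r) ^+ 2 <= 1.
  move: d0; rewrite /depth subr_gt0 => /ltW; apply: le_trans.
  by rewrite /sqdist mulr_suml; apply: ler_sum => i _; rewrite expr_div_n.
have /andP[] := cutoff_itv k x; rewrite /calibrated; under eq_bigr do rewrite mxE.
move: (cutoff k x) => e e0 e1.
apply: (@le_trans _ _ ((1 - e) * (\sum_(i < n) phi x ord0 i ^+ 2) +
    e * (\sum_(i < n) ((x ord0 i - c ord0 i) / r) ^+ 2))); last nra.
rewrite !mulr_sumr -big_split; apply: ler_sum => i _ /=.
(* The convexity gap of the square at weights 1 - e and e is e (1 - e) (a - b)^2. *)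
move: (phi x ord0 i) ((x ord0 i - c ord0 i) / r) => a b.
rewrite -subr_ge0 (_ : _ - _ = e * (1 - e) * (a - b) ^+ 2); last by ring.
by apply: mulr_ge0; [apply: mulr_ge0; rewrite ?subr_ge0|exact: sqr_ge0].
Qed.

Lemma calibrated_coordE k phi j : (fun y => calibrated k phi y ord0 j) =
  (fun y => phi y ord0 j) +
  cutoff k * (r^-1 *: ((fun y : 'rV[R]_n => y ord0 j) - cst (c ord0 j)) - (fun y => phi y ord0 j)).
Proof.
by apply/funext => y; rewrite /calibrated mxE !fctE [_ / r]mulrC.
Qed.

Lemma is_derive_calibrated k phi x i j : differentiable phi x ->
  is_derive x (e_ i) (fun y => calibrated k phi y ord0 j)
   ((1 - cutoff k x) * 'D_(e_ i) (fun y => phi y ord0 j) x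
    + cutoff k x * ((i == j)%:R / r)
    + dprofile k (depth x) * (- 2 * (x ord0 i - c ord0 i) / r ^+ 2) *
      ((x ord0 j - c ord0 j) / r - phi x ord0 j)).
Proof.
move=> dphi.
have d1 : is_derive x (e_ i) (fun y => phi y ord0 j) ('D_(e_ i) (fun y => phi y ord0 j) x).
  by apply: derivableP; apply: diff_derivable; exact: differentiable_rV_coord.
have d2 : is_derive x (e_ i) (fun y : 'rV[R]_n => y ord0 j) (e_ i ord0 j).
  exact: is_derive_coord.
have d3 := is_derive_cutoff k x i.
rewrite calibrated_coordE.
have dc := is_derive_cst (c ord0 j) x (e_ i).
have d4 := is_deriveB (is_deriveZ r^-1 (is_deriveB d2 dc)) d1.
apply: (is_derive_eq (is_deriveD d1 (is_deriveM d3 d4))).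
rewrite !fctE !mxE /= (eq_sym j i) -!/(_ * _).
rewrite subr0 /GRing.scale /=.
ring.
Qed.

(** The first two summands interpolate between div phi and n/r, the divergence of (x - c)/r. The
    last one is the gradient of the cutoff, a multiple of x - c, paired with (x - c)/r - phi. *)
Lemma divergence_calibrated k phi x : differentiable phi x ->
  divergence (calibrated k phi) x =
    (1 - cutoff k x) * divergence phi x + cutoff k x * (n%:R / r)
    + dprofile k (depth x) * (2 / r ^+ 2) *
      (\sum_(i < n) (x ord0 i - c ord0 i) * phi x ord0 i - sqdist x / r).
Proof.
move=> dphi; rewrite /divergence.
rewrite (eq_bigr (fun i => (1 - cutoff k x) * 'D_(e_ i) (fun y => phi y ord0 i) x
    + cutoff k x * r^-1
    + dprofile k (depth x) * (2 / r ^+ 2) * ((x ord0 i - c ord0 i) * phi x ord0 i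
      - (x ord0 i - c ord0 i) ^+ 2 / r))).
  rewrite !big_split /= -!mulr_sumr sumr_const card_ord -[r^-1 *+ n]mulr_natl.
  by rewrite sumrB -mulr_suml.
move=> i _; have [_ ->] := @is_derive_calibrated k phi x i i dphi.
rewrite eqxx mul1r; congr (_ + _).
by field; rewrite gt_eqF.
Qed.

(** The last bracket of [divergence_calibrated] is at most r u / 2 inside the ball, where u is the
    depth. This second factor u, besides the one in [dprofile], is what keeps the error bounded as k
    grows. *)
Lemma divergence_calibrated_le k phi x : differentiable phi x -> enorm (phi x) <= 1 ->
  divergence (calibrated k phi) x <=
    (1 - cutoff k x) * divergence phi x + cutoff k x * (n%:R / r)
    + 2 / r * (k.+1%:R * Num.max (depth x) 0 ^+ 2 * (1 - Num.max (depth x) 0 ^+ 2) ^+ k).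
Proof.
move=> dphi; rewrite enorm_le1 => phi1.
rewrite divergence_calibrated// lerD2l.
have [d0|d0] := leP (depth x) 0.
  by rewrite /dprofile max_r// !(mul0r, mulr0, expr0n).
(* Young's inequality, using |phi x| <= 1 *)
have H : \sum_(i < n) (x ord0 i - c ord0 i) * phi x ord0 i <= (r + sqdist x / r) / 2.
  apply: (@le_trans _ _
    (\sum_(i < n) ((x ord0 i - c ord0 i) ^+ 2 / r + r * phi x ord0 i ^+ 2) / 2)).
    apply: ler_sum => i _; rewrite -subr_ge0.
    move: (_ - _) (phi x ord0 i) => a b.
    rewrite (_ : _ - _ = (a - r * b) ^+ 2 / r / 2); last by field; rewrite gt_eqF.
    by apply: divr_ge0 => //; apply: divr_ge0; [exact: sqr_ge0|exact: ltW].
  rewrite -mulr_suml ler_pM2r ?invr_gt0// big_split /= -mulr_suml -mulr_sumr addrC.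
  by rewrite lerD2r// ger_pMr.
rewrite /dprofile max_l; last exact: ltW.
have Q : 0 <= (1 - depth x ^+ 2) ^+ k.
  by apply: exprn_ge0; have := depth_le1 x => ?; nra.
apply: (@le_trans _ _
  (k.+1%:R * (1 - depth x ^+ 2) ^+ k * (2 * depth x) * (2 / r ^+ 2) * (r * depth x / 2))).
  apply: ler_wpM2l.
    apply: mulr_ge0; last by rewrite divr_ge0// sqr_ge0.
    apply: mulr_ge0; last by rewrite mulr_ge0// ltW.
    by apply: mulr_ge0.
  (* What remains is (r - sqdist x / r) / 2, which is r * depth x / 2. *)
  apply: (le_trans (lerB H (lexx _))).
  rewrite le_eqVlt; apply/orP; left; apply/eqP; rewrite /depth.
  by field; rewrite gt_eqF.
rewrite le_eqVlt; apply/orP; left; apply/eqP.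
by field; rewrite gt_eqF.
Qed.

Lemma C1_calibrated k phi : C1 phi -> C1 (calibrated k phi).
Proof.
move=> C1phi; have [dphi _] := C1phi.
have [dphij cphi] := (C1P phi).1 C1phi.
have cphij j : continuous (fun y => phi y ord0 j).
  by move=> y; apply: differentiable_continuous.
have ccoord j : continuous (fun y : 'rV[R]_n => (y ord0 j - c ord0 j)).
  by apply: continuous_subf; [exact: coord_continuous|exact: cst_continuous].
apply/C1P; split=> [j x|i j].
  rewrite calibrated_coordE; apply: differentiableD => //.
  apply: differentiableM; first exact: differentiable_cutoff.
  apply: differentiableB => //; apply: differentiableZ; apply: differentiableB => //.
  exact: differentiable_coord.
rewrite (_ : 'D_ _ _ = fun x => (1 - cutoff k x) * 'D_(e_ i) (fun y => phi y ord0 j) x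
    + cutoff k x * ((i == j)%:R / r)
    + dprofile k (depth x) * (- 2 * (x ord0 i - c ord0 i) / r ^+ 2) *
      ((x ord0 j - c ord0 j) / r - phi x ord0 j)); last first.
  by apply/funext => x; have [_ ->] := @is_derive_calibrated k phi x i j (dphi x).
apply: continuous_addf; first apply: continuous_addf.
- apply: continuous_mulf; last exact: cphi.
  by apply: continuous_subf; [exact: cst_continuous|exact: continuous_cutoff].
- by apply: continuous_mulf; [exact: continuous_cutoff|exact: cst_continuous].
- apply: continuous_mulf; last first.
    apply: continuous_subf; last exact: cphij.
    by apply: continuous_mulf; [exact: ccoord|exact: cst_continuous].
  apply: continuous_mulf.
    move=> x; apply: continuous_comp; first exact: continuous_depth.
    exact: continuous_dprofile.
  apply: continuous_mulf; last exact: cst_continuous.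
  by apply: continuous_mulf; [exact: cst_continuous|exact: ccoord].
Qed.

End calibration.

(** * Passage to the limit *)

Section comparison_limit.
Context d (T : measurableType d) (R : realType) (mu : {measure set T -> \bar R}).
Variables (S B K : set T).
Hypotheses (mS : measurable S) (mB : measurable B) (mK : measurable K).
Hypotheses (BK : B `<=` K) (Koo : (mu K < +oo)%E).

Lemma integrable_bounded_support (D : set T) (f : T -> R) (C : R) :
  measurable D -> measurable_fun setT f -> (forall x, K x -> `|f x| <= C) ->
  (forall x, ~ K x -> f x = 0) -> mu.-integrable D (EFin \o f).
Proof.
move=> mD mf fC f0; apply: (integrableS measurableT) => //.
rewrite (_ : EFin \o f = (EFin \o f) \_ K); last first.
  apply/funext => x; rewrite /patch; case: ifPn => //.
  by rewrite notin_setE => /f0 /= ->.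
apply/(integrable_mkcond _ mK).
apply: measurable_bounded_integrable => //; first exact: measurable_funTS.
exists C; split; first exact: num_real.
by move=> N CN x /= Kx; rewrite (le_trans (fC _ Kx))// ltW.
Qed.

Lemma integral_setC_eq0 (D : set T) (f : T -> R) : measurable D ->
  mu.-integrable setT (EFin \o f) -> (\int[mu]_x (f x)%:E = 0)%E ->
  (\int[mu]_(x in ~` D) (f x)%:E = - \int[mu]_(x in D) (f x)%:E)%E.
Proof.
move=> mD If.
have mCD : measurable (~` D) by exact: measurableC.
have ID : mu.-integrable D (EFin \o f) by exact: (integrableS measurableT).
have ICD : mu.-integrable (~` D) (EFin \o f) by exact: (integrableS measurableT).
rewrite -(setvU D) integral_setU//; last 2 first.
- by rewrite setvU; exact: measurable_int If.
- by apply/disj_setPS => x [].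
have /fineK <- := integrable_fin_num mD ID.
have /fineK <- := integrable_fin_num mCD ICD.
by rewrite -EFinD -EFinN => -[] /eqP; rewrite addr_eq0 => /eqP ->.
Qed.

Variables (f : T -> R) (f_ g_ : nat -> T -> R) (a C : R) (P : \bar R).
Hypotheses (mf : measurable_fun setT f) (mf_ : forall k, measurable_fun setT (f_ k))
  (mg_ : forall k, measurable_fun setT (g_ k)).
Hypotheses (fC : forall x, K x -> `|f x| <= C) (f0 : forall x, ~ K x -> f x = 0).
Hypotheses (f_C : forall k, exists C, forall x, K x -> `|f_ k x| <= C)
  (f_0 : forall k x, ~ K x -> f_ k x = 0).
Hypotheses (g_C : forall k x, K x -> `|g_ k x| <= C) (g_0 : forall k x, ~ K x -> g_ k x = 0).
Hypotheses (int_f : (\int[mu]_x (f x)%:E = 0)%E)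
  (int_f_ : forall k, (\int[mu]_x (f_ k x)%:E = 0)%E).
Hypothesis f_P : forall k, (\int[mu]_(x in S) (f_ k x)%:E <= P)%E.
Hypothesis f_g_ : forall k x, f_ k x <= g_ k x.
Hypothesis cvg_g_ : {ae mu, forall x, g_ ^~ x @ \oo --> if x \in B then a else f x}.

(** Here [f] stands for div phi, [f_ k] for the divergence of the k-th calibrated field, [g_ k] for
    its upper bound, [a] for n/r and [P] for Per(S). Since [f_ k] has zero mean, its bound P on S
    gives the lower bound -P on the complement of S, which passes to [g_ k] and, by dominated
    convergence, to the limit. The complement of S splits into that of B U S, where the limit is f,
    and B \ S, where it is a. Only [g_] needs a bound uniform in k; those on [f_] just give
    integrability. *)
Lemma comparison_limit :
  (\int[mu]_(x in B `|` S) (f x)%:E <= P + a%:E * mu (B `\` S))%E.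
Proof.
have mG : measurable (~` S) by exact: measurableC.
have mBS : measurable (B `|` S) by exact: measurableU.
have mSB : measurable (B `\` S) by exact: measurableD.
have If D : measurable D -> mu.-integrable D (EFin \o f).
  by move=> mD; exact: (@integrable_bounded_support D f C).
have If_ D k : measurable D -> mu.-integrable D (EFin \o f_ k).
  by move=> mD; have [Ck HC] := f_C k;
    apply: (@integrable_bounded_support D _ Ck) => //; exact: f_0.
have Ig_ D k : measurable D -> mu.-integrable D (EFin \o g_ k).
  by move=> mD; apply: (@integrable_bounded_support D _ C) => //; [exact: g_C|exact: g_0].
pose g x := if x \in B then a else f x.
have mg : measurable_fun setT g.
  apply: measurable_fun_ifT => //.
  by apply: (measurable_fun_bool true); rewrite setTI preimage_mem_true.
have PG k : (- P <= \int[mu]_(x in ~` S) (g_ k x)%:E)%E.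
  apply: (@le_trans _ _ (\int[mu]_(x in ~` S) (f_ k x)%:E)%E).
    by rewrite integral_setC_eq0 ?leeN2//; exact: If_.
  by apply: le_integral => //; [exact: If_|exact: Ig_|];
    move=> x _; rewrite lee_fin; exact: f_g_.
have [_ _ cvgI] : [/\ mu.-integrable (~` S) (EFin \o g),
    [sequence \int[mu]_(x in ~` S) `|(g_ n x)%:E - (EFin \o g) x|%E]_n @ \oo --> 0%E &
    [sequence \int[mu]_(x in ~` S) (g_ n x)%:E]_n @ \oo -->
      \int[mu]_(x in ~` S) (EFin \o g) x]%E.
  apply: (@dominated_convergence _ _ _ mu _ mG (fun k => EFin \o g_ k) (EFin \o g)
    (EFin \o (fun x => C * \1_K x))).
  - by move=> k; apply/measurable_EFinP; exact: measurable_funTS.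
  - by apply/measurable_EFinP; exact: measurable_funTS.
  - apply: filterS cvg_g_ => x gx _; apply: cvg_EFin; last exact: gx.
    exact: nearW.
  - apply: (@integrable_bounded_support _ _ `|C|) => //.
    + exact: measurable_funM.
    + by move=> x Kx; rewrite indicE mem_set// mulr1.
    + by move=> x Kx; rewrite indicE memNset// mulr0.
  - apply: aeW => x k _ /=; rewrite lee_fin indicE.
    have [Kx|Kx] := pselect (K x); first by rewrite mem_set// mulr1 g_C.
    by rewrite memNset// mulr0 g_0 ?normr0.
have {}PG : (- P <= \int[mu]_(x in ~` S) (g x)%:E)%E.
  by apply: (cvge_to_ge cvgI); exact: nearW.
have GE : ~` S = ~` (B `|` S) `|` (B `\` S).
  apply/seteqP; split=> x /=.
    move=> Sx; have [Bx|Bx] := pselect (B x); [by right|by left => -[]].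
  by move=> [xBS Sx|[]//]; apply: xBS; right.
have /fineK Ffin := integrable_fin_num mBS (If _ mBS).
have SBfin : mu (B `\` S) \is a fin_num.
  rewrite ge0_fin_numE//; apply: le_lt_trans Koo; apply: le_measure; rewrite ?inE//.
  by move=> x [/BK].
have E : (\int[mu]_(x in ~` S) (g x)%:E =
    (- (\int[mu]_(x in B `|` S) (f x)%:E)) + a%:E * mu (B `\` S))%E.
  rewrite GE integral_setU//; first last.
  - by apply/disj_setPS => x [] /= nBS [Bx _]; apply: nBS; left.
  - by apply/measurable_EFinP; exact: measurable_funTS.
  - exact: measurableC.
  congr (_ + _)%E.
    rewrite -integral_setC_eq0//; last exact: If.
    apply: eq_integral => x; rewrite inE /= => nBS; rewrite /g memNset//.
    by move=> Bx; apply: nBS; left.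
  rewrite -integral_cst//; apply: eq_integral => x; rewrite inE => -[Bx _].
  by rewrite /g mem_set.
move: PG; rewrite E -Ffin.
have /fineK <- := SBfin.
(* For P = +oo the conclusion is trivial, and for P = -oo the lower bound -P fails. *)
case: (P) => [p| |]; rewrite -?EFinN -?EFinM -?EFinD ?lee_fin ?leey//.
by move=> ?; lra.
Qed.

End comparison_limit.

(** * Bounds and limits of the cutoff profile *)

Section profile_limits.
Variable R : realType.

(** The sharper bound 1 - (1 - q)^(k+1) passes through induction: it is q times the sum of the k + 1
    powers (1 - q)^j with j <= k, each at least (1 - q)^k. *)
Lemma bernoulli_tail (q : R) k : 0 <= q <= 1 -> k.+1%:R * q * (1 - q) ^+ k <= 1.
Proof.
move=> /andP[q0 q1].
suff : k.+1%:R * q * (1 - q) ^+ k <= 1 - (1 - q) ^+ k.+1.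
  move=> /le_trans; apply; rewrite lerBlDr lerDl exprn_ge0//; lra.
have p0 : 0 <= 1 - q by lra.
elim: k => [|k IH]; first by rewrite expr0 expr1; lra.
have p1 : (1 - q) ^+ k.+1 <= 1 by rewrite exprn_ile1//; lra.
move: p1 IH; rewrite !exprS -[k.+2%:R]natr1.
move: ((1 - q) ^+ k) (k.+1%:R : R) => z m p1 IH.
have := ler_wpM2l p0 IH; have := ler_wpM2l q0 p1; lra.
Qed.

Lemma cvg_bernoulli_tail (q : R) : 0 <= q <= 1 ->
  (fun k => k.+1%:R * q * (1 - q) ^+ k) @ \oo --> (0 : R).
Proof.
move=> /andP[q0 q1].
have [->|qn0] := eqVneq q 0.
  by under eq_fun do rewrite mulr0 mul0r; exact: cvg_cst.
have {}q0 : 0 < q by rewrite lt_def qn0.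
(* With y^2 = 1 - q, the bound (k+1)(1 - y)y^k <= 1 leaves a spare factor y^k. *)
pose y := Num.sqrt (1 - q).
have y2 : y ^+ 2 = 1 - q by rewrite sqr_sqrtr// subr_ge0.
have y0 : 0 <= y by exact: sqrtr_ge0.
have y1 : y < 1 by nra.
apply: (@squeeze_cvgr _ _ _ _ (cst 0) (fun k => (q / (1 - y)) * y ^+ k)).
- apply: nearW => k; apply/andP; split.
    apply: mulr_ge0; first by apply: mulr_ge0 => //; exact: ltW.
    by apply: exprn_ge0; rewrite subr_ge0.
  have := @bernoulli_tail (1 - y) k; rewrite opprB addrCA subrr addr0 => H.
  have {}H : k.+1%:R * (1 - y) * y ^+ k <= 1 by apply: H; apply/andP; split; lra.
  rewrite -y2 -exprM mulnC exprM expr2.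
  have yk : 0 <= y ^+ k by exact: exprn_ge0.
  rewrite -subr_ge0 (_ : _ - _ =
    (1 - k.+1%:R * (1 - y) * y ^+ k) * (q / (1 - y) * y ^+ k)); last first.
    by field; rewrite gt_eqF// subr_gt0.
  apply: mulr_ge0; first by rewrite subr_ge0.
  by rewrite mulr_ge0// divr_ge0 ?subr_ge0 ?ltW.
- exact: cvg_cst.
- rewrite -[X in _ --> X](mulr0 (q / (1 - y))).
  by apply: cvgM; [exact: cvg_cst|apply: cvg_expr; rewrite ger0_norm].
Qed.

Lemma cvg_profile (s : R) : s <= 1 ->
  (fun k => profile k s) @ \oo --> (if 0 < s then 1 else 0 : R).
Proof.
move=> s1; rewrite /profile; have [s0|s0] := ltP 0 s; last first.
  by under eq_fun do rewrite expr0n/= subr0 expr1n subrr; exact: cvg_cst.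
rewrite -[X in _ --> X]subr0; apply: cvgB; first exact: cvg_cst.
have q : `|1 - s ^+ 2| < 1.
  have ? : s ^+ 2 <= 1 by rewrite exprn_ile1// ltW.
  rewrite ger0_norm ?subr_ge0// ltrBlDr ltrDl exprn_gt0//.
have := cvg_expr q; rewrite -(cvg_shiftS (fun k => (1 - s ^+ 2) ^+ k)); exact.
Qed.

End profile_limits.

(** * Divergences of compactly supported fields *)

Section box_support.
Variables (R : realType) (n : nat).
Implicit Types (phi : 'rV[R]_n -> 'rV[R]_n) (M : R).

Definition supported_in_box M phi := forall x, ~ box M x -> phi x = 0.

Lemma ler_norm_rV (x : 'rV[R]_n) i : `|x ord0 i| <= `|x|.
Proof.
rewrite [leRHS]/Num.Def.normr /= mx_normrE.
exact: (le_bigmax _ (fun ij => `|x ij.1 ij.2|) (ord0, i)).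
Qed.

Lemma box_norm (x : 'rV[R]_n) : box `|x| x.
Proof. by move=> i; rewrite in_itv /= -ler_norml ler_norm_rV. Qed.

Lemma box_le M N (x : 'rV[R]_n) : M <= N -> box M x -> box N x.
Proof.
by move=> MN Bx i; have := Bx i; rewrite !in_itv /= => /andP[? ?]; apply/andP; split; lra.
Qed.

Lemma closed_box M : closed (@box R n M).
Proof. by apply: compact_closed; [exact: norm_hausdorff|exact: compact_box]. Qed.

Lemma compactly_supported_box phi : compactly_supported phi ->
  exists M, supported_in_box M phi.
Proof.
move=> /compact_bounded[N [_ HN]]; exists (N + 1) => x xM.
apply: contrapT => /eqP phix; apply: xM.
apply: (box_le _ (@box_norm x)); apply: (HN (N + 1)); first by rewrite ltrDl.
exact: subset_closure.
Qed.

Lemma supported_in_box_compact M phi : supported_in_box M phi -> compactly_supported phi.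
Proof.
move=> phi0; apply: (subclosed_compact _ (@compact_box R n M)).
  exact: closed_closure.
rewrite [X in _ `<=` X](closure_id _).1; last exact: closed_box.
apply: closure_subset => x /= /eqP phix; apply: contrapT => /phi0; exact.
Qed.

(** The box is closed, so f vanishes in a neighbourhood of each point outside it. *)
Lemma derive_supported_in_box M (f : 'rV[R]_n -> R) v :
  (forall x, ~ box M x -> f x = 0) -> forall x, ~ box M x -> 'D_v f x = 0.
Proof.
move=> f0 x xM; rewrite -[RHS](derive_cst (V := 'rV[R]_n) 0 x v).
apply: near_eq_derive.
have : nbhs x (~` box M) by apply: open_nbhs_nbhs; split=> //; exact/closed_openC/closed_box.
by apply: filterS => y; exact: f0.
Qed.

Section divergence.
Variables (M : R) (phi : 'rV[R]_n -> 'rV[R]_n).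
Hypotheses (C1phi : C1 phi) (phi0 : supported_in_box M phi).

Lemma continuous_divergence : continuous (divergence phi).
Proof.
have [_ cphi] := (C1P phi).1 C1phi.
by apply: continuous_sumf => i; exact: cphi.
Qed.

Let partial0 i x : ~ box M x -> 'D_(delta_mx ord0 i) (fun y => phi y ord0 i) x = 0.
Proof.
by apply: derive_supported_in_box => y /phi0 ->; rewrite mxE.
Qed.

Lemma divergence_supported_in_box x : ~ box M x -> divergence phi x = 0.
Proof. by move=> xM; rewrite /divergence big1// => i _; exact: partial0. Qed.

Lemma integral_divergence_eq0 : (\int[lebesgue_rV R n]_x (divergence phi x)%:E = 0)%E.
Proof.
have [dphi cphi] := (C1P phi).1 C1phi.
have Ii i := integrable_box (cphi i i) (@partial0 i).
rewrite (@integral_completed R n (EFin \o divergence phi)); last first.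
  exact: integrable_box continuous_divergence divergence_supported_in_box.
under eq_integral do rewrite /= /divergence -sumEFin.
rewrite integral_sum// big1// => i _.
apply: (@integral_partial_eq0 R n i (fun y => phi y ord0 i) _ M).
- by move=> x; apply: derivableP; apply: diff_derivable; exact: dphi.
- exact: cphi.
- by move=> x /phi0 ->; rewrite mxE.
- by move=> x; exact: partial0.
Qed.

End divergence.

End box_support.

(** * Perimeter and balls *)

Lemma measurable_sphere (R : realType) n (c : 'rV[R]_n) (r : R) :
  measurable [set x | depth c r x = 0].
Proof.
rewrite -[X in measurable X]setTI.
have := continuous_measurable_rV (@continuous_depth R n c r).
by move=> /(_ measurableT [set 0]); apply; exact: measurable_set1.
Qed.

(** A line parallel to the first axis meets the sphere in at most two points. *)
Lemma borel_lebesgue_sphere (R : realType) n (c : 'rV[R]_n) (r : R) :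
  (0 < n)%N -> 0 < r -> borel_lebesgue R n [set x | depth c r x = 0] = 0%E.
Proof.
case: n c => // n c _ r0; apply: borel_lebesgue_countable_sections.
  exact: measurable_sphere.
move=> y.
(* The section over y is the solution set of (t - c_0)^2 = D; it is empty when D < 0, so the two
   points below cover it in every case. *)
pose D := r ^+ 2 - \sum_(i < n) (y ord0 i - c ord0 (lift ord0 i)) ^+ 2.
have r2 : r ^+ 2 != 0 by rewrite expf_neq0// gt_eqF.
apply: (@sub_countable _ _ _ [set c ord0 ord0 + Num.sqrt D; c ord0 ord0 - Num.sqrt D]).
  apply: subset_card_le => t /= /eqP; rewrite /depth subr_eq0 eq_sym.
  rewrite -(inj_eq (mulIf r2)) divfK// mul1r /sqdist big_ord_recl rV_cons0 => /eqP H.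
  have : (t - c ord0 ord0) ^+ 2 == D.
    apply/eqP; rewrite /D -H; under eq_bigr do rewrite rV_consS.
    by rewrite addrK.
  move=> /eqP H'; have D0 : 0 <= D by rewrite -H' sqr_ge0.
  have : (t - c ord0 ord0) ^+ 2 == Num.sqrt D ^+ 2 by rewrite sqr_sqrtr// H'.
  rewrite eqf_sqr => /orP[] /eqP h; [left|right]; rewrite -h; ring.
by apply: finite_set_countable; exact: finite_set2.
Qed.

Section perimeter_comparison.
Variables (R : realType) (n : nat).
Implicit Types (A B S : set 'rV[R]_n) (phi : 'rV[R]_n -> 'rV[R]_n).
Local Notation mu := (lebesgue_rV R n).
Local Notation T := (caratheodory_type ((borel_lebesgue R n)^*)%mu).

Lemma continuous_lebesgue_measurable (f : 'rV[R]_n -> R) :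
  continuous f -> measurable_fun [set: T] (f : T -> R).
Proof. by move=> cf; apply: measurable_completed; exact: continuous_measurable_rV. Qed.

Lemma lebesgue_measurable_box M : lebesgue_measurable (@box R n M).
Proof. by apply: borel_lebesgue_measurable; exact: measurable_box. Qed.

Lemma lebesgue_box_lty M : (mu (@box R n M) < +oo)%E.
Proof.
by rewrite lebesgue_rVE; [exact: borel_lebesgue_box_lty|exact: measurable_box].
Qed.

Lemma integrable_divergence M phi D : C1 phi -> supported_in_box M phi ->
  lebesgue_measurable D -> mu.-integrable D (EFin \o divergence phi).
Proof.
move=> C1phi phi0 mD; have cdiv := continuous_divergence C1phi.
have [C HC] := continuous_box_bounded M cdiv.
apply: (@integrable_bounded_support _ T R mu (box M) _ _ _ _ C) => //.
- exact: lebesgue_measurable_box.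
- exact: lebesgue_box_lty.
- exact: continuous_lebesgue_measurable.
- exact: divergence_supported_in_box.
Qed.

Lemma C1N phi : C1 phi -> C1 (- phi).
Proof.
move=> /C1P[dphi cphi].
have E j : (fun y => (- phi) y ord0 j) = - (fun y => phi y ord0 j).
  by apply/funext => y; rewrite !fctE mxE.
apply/C1P; split=> [j x|i j]; rewrite E; first exact: differentiableN.
have -> : 'D_(delta_mx ord0 i) (- (fun y => phi y ord0 j)) =
    - 'D_(delta_mx ord0 i) (fun y => phi y ord0 j).
  by apply/funext => x; rewrite deriveN//; exact: diff_derivable.
by move=> x; apply: continuousN; exact: cphi.
Qed.

Lemma divergenceN phi x : C1 phi -> divergence (- phi) x = - divergence phi x.
Proof.
move=> /C1P[dphi _]; rewrite /divergence -sumrN; apply: eq_bigr => i _.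
rewrite (_ : (fun y => (- phi) y ord0 i) = - (fun y => phi y ord0 i)); last first.
  by apply/funext => y; rewrite !fctE mxE.
by rewrite deriveN//; exact: diff_derivable.
Qed.

(** As div phi has zero mean, the flux of phi through the complement of A is that of -phi, again a
    test field, through A. *)
Lemma perimeter_setC A : lebesgue_measurable A -> (perimeter (~` A) <= perimeter A)%E.
Proof.
move=> mA; apply: ge_ereal_sup => _ [phi [C1phi /compactly_supported_box[M phi0] phi1] <-].
rewrite (@integral_setC_eq0 _ T R mu A (divergence phi)); first last.
- exact: integral_divergence_eq0 phi0.
- exact: integrable_divergence phi0 measurableT.
- exact: mA.
apply: ereal_sup_ubound; exists (- phi); first split.
- exact: C1N.
- by apply: (@supported_in_box_compact _ _ M) => x /phi0; rewrite fctE => ->; rewrite oppr0.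
- move=> x; rewrite enorm_le1 fctE; under eq_bigr do rewrite mxE sqrrN.
  by rewrite -enorm_le1.
have Idiv := integrable_divergence C1phi phi0 mA.
rewrite -integralN; last exact: integrable_add_def Idiv.
by apply: eq_integral => x _; rewrite divergenceN.
Qed.

(** Squeezing B between the open and the closed ball treats both kinds of balls at once. On the
    sphere the cutoffs vanish whether or not the point is in B, so convergence may fail there, but
    the sphere is null. *)
Lemma perimeter_ball_setU S B (c : 'rV[R]_n) (r : R) : (0 < n)%N -> 0 < r ->
  lebesgue_measurable S -> lebesgue_measurable B ->
  eball_open c r `<=` B -> B `<=` eball_closed c r ->
  (perimeter (B `|` S) <= perimeter S + (n%:R / r)%:E * mu (B `\` S))%E.
Proof.
move=> n0 r0 mS mB; rewrite eball_openE// eball_closedE// => oB Bc.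
apply: ge_ereal_sup => _ [phi [C1phi /compactly_supported_box[M0 phi0] phi1] <-].
(* This box contains the support of phi and the closed ball, hence the support of every calibrated
   field. *)
pose M : R := `|M0| + (`|c| + r).
have depth_box x : 0 <= depth c r x -> box M x.
  move=> dx i; rewrite in_itv /= -ler_norml.
  apply: (@le_trans _ _ (`|c| + r)); last by rewrite lerDr.
  rewrite -(subrK (c ord0 i) (x ord0 i)) addrC (le_trans (ler_normD _ _))//.
  rewrite lerD ?ler_norm_rV//.
  rewrite -(ler_pXn2r (_ : 0 < 2)%N) ?nnegrE ?(ltW r0)// real_normK ?num_real//.
  move: dx; rewrite /depth subr_ge0 ler_pdivrMr ?exprn_gt0// mul1r; apply: le_trans.
  rewrite /sqdist (bigD1 i)//= lerDl; apply: sumr_ge0 => j _; exact: sqr_ge0.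
have {}phi0 : supported_in_box M phi.
  move=> x xM; apply: phi0; apply: contra_not xM; apply: box_le.
  by rewrite (le_trans (ler_norm _))// lerDl addr_ge0//; exact: ltW.
have psi0 k : supported_in_box M (calibrated c r k phi).
  move=> x xM; apply/rowP => j; rewrite mxE cutoff_eq0; last first.
    by rewrite leNgt; apply/negP => /ltW /depth_box.
  by rewrite mul0r addr0 phi0.
have C1psi k : C1 (calibrated c r k phi) by exact: C1_calibrated.
have cpsi k := continuous_divergence (C1psi k).
have dphi : forall x, differentiable phi x by have [] := C1phi.
have cdiv := continuous_divergence C1phi.
have [Cf HCf] := continuous_box_bounded M cdiv.
pose q x : R := Num.max (depth c r x) 0 ^+ 2.
have q01 x : 0 <= q x <= 1.
  rewrite /q sqr_ge0 /=; have := depth_le1 c r x.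
  have [d0 _|d0 d1] := leP (depth c r x) 0; first by rewrite expr0n/= ler01.
  by rewrite exprn_ile1// ltW.
have cq : continuous q.
  apply: continuous_expf => x.
  apply: (@continuous_comp _ _ _ (depth c r) (fun s : R => Num.max s 0)).
    exact: continuous_depth.
  exact: continuous_max0.
(* The bound of [divergence_calibrated_le], with q for the squared positive part of the depth. *)
pose g_ k x : R := (1 - cutoff c r k x) * divergence phi x + cutoff c r k x * (n%:R / r)
    + 2 / r * (k.+1%:R * q x * (1 - q x) ^+ k).
have cg k : continuous (g_ k).
  have ccut := @continuous_cutoff R n c r k.
  apply: continuous_addf; first apply: continuous_addf.
  - apply: continuous_mulf => //; apply: continuous_subf => //; exact: cst_continuous.
  - apply: continuous_mulf => //; exact: cst_continuous.
  - apply: continuous_mulf; first exact: cst_continuous.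
    apply: continuous_mulf.
      by apply: continuous_mulf => //; exact: cst_continuous.
    by apply: continuous_expf; apply: continuous_subf => //; exact: cst_continuous.
have msphere := measurable_sphere c r.
have a0 : 0 <= n%:R / r by rewrite divr_ge0// ltW.
have b0 : 0 <= 2 / r by rewrite divr_ge0// ltW.
(* The uniform bound on [g_] has one term for each of its summands: Cf for div phi, n/r for the
   calibration, and 2/r for the error by [bernoulli_tail]. *)
apply: (@comparison_limit _ T R mu S B (box M) mS mB (lebesgue_measurable_box M) _
  (lebesgue_box_lty M) (divergence phi) (fun k => divergence (calibrated c r k phi)) g_
  (n%:R / r) (Cf + n%:R / r + 2 / r)).
- by move=> x /Bc /depth_box.
- exact: continuous_lebesgue_measurable.
- move=> k; exact: (continuous_lebesgue_measurable (cpsi k)).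
- move=> k; exact: (continuous_lebesgue_measurable (cg k)).
- by move=> x /HCf /le_trans; apply; rewrite -addrA lerDl addr_ge0.
- exact: (divergence_supported_in_box phi0).
- move=> k; exact: (continuous_box_bounded M (cpsi k)).
- move=> k; exact: (divergence_supported_in_box (psi0 k)).
- move=> k x xM; rewrite /g_.
  have /andP[e0 e1] := cutoff_itv c r k x.
  have t1 := bernoulli_tail k (q01 x).
  have t0 : 0 <= k.+1%:R * q x * (1 - q x) ^+ k.
    have /andP[? ?] := q01 x.
    by apply: mulr_ge0; [exact: mulr_ge0|rewrite exprn_ge0// subr_ge0].
  apply: (le_trans (ler_normD _ _)); apply: lerD.
    apply: (le_trans (ler_normD _ _)); apply: lerD; rewrite normrM.
      rewrite ger0_norm ?subr_ge0//; apply: le_trans (HCf _ xM).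
      by rewrite ler_piMl// gerBl.
    by rewrite !ger0_norm// ler_piMl.
  rewrite ger0_norm; last exact: mulr_ge0.
  by rewrite -[leRHS]mulr1; exact: ler_wpM2l.
- move=> k x xM; have d0 : depth c r x <= 0.
    by rewrite leNgt; apply/negP => /ltW /depth_box.
  rewrite /g_ (divergence_supported_in_box phi0 xM) cutoff_eq0// /q max_r//.
  by rewrite expr0n !(mul0r, mulr0, addr0).
- exact: (integral_divergence_eq0 C1phi phi0).
- move=> k; exact: (integral_divergence_eq0 (C1psi k) (psi0 k)).
- move=> k; apply: ereal_sup_ubound; exists (calibrated c r k phi); last exact: erefl.
  split; [exact: (C1psi k)|exact: (supported_in_box_compact (psi0 k))|].
  by move=> x; exact: enorm_calibrated.
- move=> k x; exact: (divergence_calibrated_le c r0 k (dphi x) (phi1 x)).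
- exists [set x | depth c r x = 0]; split.
  + exact: (borel_lebesgue_measurable msphere).
  + by rewrite -(borel_lebesgue_sphere c n0 r0); exact: (lebesgue_rVE msphere).
  + move=> x /=; apply: contra_notP => /eqP d0.
    have -> : (x \in B) = (0 < depth c r x).
      apply/idP/idP; rewrite inE; last exact: oB.
      by move=> /Bc /=; rewrite lt_neqAle eq_sym d0.
    have ce := cvg_profile (depth_le1 c r x).
    (* The limit is put in the shape of [g_], with the indicator of the open ball for the cutoff and
       0 for the error, to pass to the limit termwise. *)
    have -> : (if 0 < depth c r x then n%:R / r else divergence phi x) =
      (1 - (if 0 < depth c r x then 1 else 0)) * divergence phi x +
      (if 0 < depth c r x then 1 else 0) * (n%:R / r) + 2 / r * 0.
      by case: ifP => _; rewrite ?subrr ?subr0 ?mul0r ?mul1r mulr0 ?add0r ?addr0.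
    apply: cvgD; first apply: cvgD.
    * by apply: cvgM; [apply: cvgB; [exact: cvg_cst|exact: ce]|exact: cvg_cst].
    * by apply: cvgM; [exact: ce|exact: cvg_cst].
    * by apply: cvgM; [exact: cvg_cst|exact: cvg_bernoulli_tail].
Qed.

End perimeter_comparison.

(** * Comparison of energies and the theorem *)

Section energy_comparison.
Variables (R : realType) (n : nat).
Implicit Types (A B D S Omega : set 'rV[R]_n).
Local Notation mu := (lebesgue_rV R n).
Local Notation T := (caratheodory_type ((borel_lebesgue R n)^*)%mu).

Lemma lebesgue_measurableC A : lebesgue_measurable A -> lebesgue_measurable (~` A).
Proof. by move=> mA; exact: (@measurableC _ T). Qed.

Lemma lebesgue_measurableU A B :
  lebesgue_measurable A -> lebesgue_measurable B -> lebesgue_measurable (A `|` B).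
Proof. by move=> mA mB; exact: (@measurableU _ T). Qed.

Lemma lebesgue_measurableD A B :
  lebesgue_measurable A -> lebesgue_measurable B -> lebesgue_measurable (A `\` B).
Proof. by move=> mA mB; exact: (@measurableD _ T). Qed.

Lemma lebesgue_measurableY A B :
  lebesgue_measurable A -> lebesgue_measurable B -> lebesgue_measurable (A `+` B).
Proof.
by move=> mA mB; rewrite setY_def; apply: lebesgue_measurableU; exact: lebesgue_measurableD.
Qed.

Lemma lebesgue_measurable_eball (r : R) B : 0 < r -> is_eball r B -> lebesgue_measurable B.
Proof.
move=> r0 [c [->|->]]; apply: borel_lebesgue_measurable.
  rewrite eball_openE//; apply: open_measurable_rV.
  rewrite (_ : mkset _ = depth c r @^-1` [set t | 0 < t])//.
  apply: open_comp; last exact: (@open_gt R 0).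
  by move=> x _; exact: continuous_depth.
rewrite eball_closedE//; apply: closed_measurable_rV.
rewrite (_ : mkset _ = depth c r @^-1` [set t | 0 <= t])//.
apply: preimage_closed; first by move=> x _; exact: continuous_depth.
exact: (@closed_ge R 0).
Qed.

Lemma perimeter_eball_setU (r : R) S B : (0 < n)%N -> 0 < r ->
  lebesgue_measurable S -> is_eball r B ->
  (perimeter (B `|` S) <= perimeter S + (n%:R / r)%:E * mu (B `\` S))%E.
Proof.
move=> n0 r0 mS Bball; have mB := lebesgue_measurable_eball r0 Bball.
by case: Bball mB => c [->|->] mB; apply: (@perimeter_ball_setU _ _ _ _ c) => // x;
  rewrite /eball_open /eball_closed /=; exact: ltW.
Qed.

(** Passing from A to A' removes D from the symmetric difference with Omega; the gain lambda |D|
    pays for the increase of the perimeter. *)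
Lemma energy_le lambda Omega A A' D : 0 <= lambda ->
  lebesgue_measurable (A' `+` Omega) -> lebesgue_measurable D ->
  (perimeter A' <= perimeter A + lambda%:E * mu D)%E ->
  A `+` Omega = (A' `+` Omega) `|` D -> (A' `+` Omega) `&` D = set0 ->
  (energy lambda Omega A' <= energy lambda Omega A)%E.
Proof.
move=> l0 mA' mD PA' AD AD0; rewrite /energy AD.
have -> : mu ((A' `+` Omega) `|` D) = (mu (A' `+` Omega) + mu D)%E.
  exact: (@measureU _ _ T (lebesgue_rV R n) _ _ mA' mD AD0).
rewrite muleDr//; last by apply: ge0_adde_def; rewrite inE; exact: measure_ge0.
by rewrite addeCA addeC leeD2r.
Qed.

Lemma is_minimizer_le lambda Omega A A' :
  is_minimizer lambda Omega A -> lebesgue_measurable A' ->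
  (energy lambda Omega A' <= energy lambda Omega A)%E ->
  is_minimizer lambda Omega A'.
Proof.
by move=> [_ minA] mA' leA; split=> // D mD; exact: (le_trans leA (minA D mD)).
Qed.

End energy_comparison.

Theorem theorem4 (R : realType) (n : nat) (lambda r : R)
    (Omega Sigma B : set 'rV[R]_n) :
  (2 < n)%N -> 0 < lambda -> r = n%:R / lambda ->
  bounded_set Omega -> lebesgue_measurable Omega ->
  is_minimizer lambda Omega Sigma ->
  is_eball r B ->
  (B `<=` Omega -> is_minimizer lambda Omega (B `|` Sigma)) /\
  (B `<=` ~` Omega -> is_minimizer lambda Omega (~` (B `|` ~` Sigma))).
Proof.
move=> n2 l0 rE _ mO minS Bball.
have n0 : (0 < n)%N by exact: ltn_trans n2.
have r0 : 0 < r by rewrite rE divr_gt0// ltr0n.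
have lE : lambda = n%:R / r.
  by rewrite rE invf_div mulrC divfK// pnatr_eq0 -lt0n.
have mS : lebesgue_measurable Sigma by case: minS.
have mB := lebesgue_measurable_eball r0 Bball.
have mCS := lebesgue_measurableC mS.
split=> BO; apply: (is_minimizer_le minS).
- exact: lebesgue_measurableU.
(* The points added to Sigma lie in Omega, so they leave the symmetric difference. *)
- apply: (@energy_le _ _ _ _ _ _ (B `\` Sigma)) => //.
  + exact: ltW.
  + by apply: lebesgue_measurableY => //; exact: lebesgue_measurableU.
  + exact: lebesgue_measurableD.
  + by rewrite lE; exact: perimeter_eball_setU.
  + rewrite !setY_def; apply/seteqP; split=> x /=; have /= := BO x;
      have [?|?] := pselect (Sigma x); have [?|?] := pselect (B x); tauto.
  + rewrite !setY_def; apply/seteqP; split=> x //=; have /= := BO x; tauto.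
- by apply: lebesgue_measurableC; exact: lebesgue_measurableU.
(* The points of B in Sigma, which are removed, lie outside Omega and so leave the symmetric
   difference. *)
- apply: (@energy_le _ _ _ _ _ _ (B `\` ~` Sigma)) => //.
  + exact: ltW.
  + apply: lebesgue_measurableY => //; apply: lebesgue_measurableC.
    exact: lebesgue_measurableU.
  + exact: lebesgue_measurableD.
  (* The perimeter inequality is applied to the complement of Sigma, with [perimeter_setC] used once
     on each side to return to the original sets. *)
  + apply: (le_trans (perimeter_setC (lebesgue_measurableU mB mCS))).
    rewrite lE; apply: (le_trans (perimeter_eball_setU n0 r0 mCS Bball)).
    by apply: leeD2r; exact: perimeter_setC.
  + rewrite !setY_def; apply/seteqP; split=> x /=; have /= := BO x;
      have [?|?] := pselect (Sigma x); have [?|?] := pselect (B x); tauto.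
  + rewrite !setY_def; apply/seteqP; split=> x //=; have /= := BO x;
      have [?|?] := pselect (Sigma x); tauto.
Qed.
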